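(* Let $\mathrm{L}$ be a Markov operator with invariant and reversible probability measure $\mu$, carré du champ $\Gamma$, and pure point spectrum $S=\{0=\lambda_0<\lambda_1<\lambda_2<\cdots\}$ (the spectrum of $-\mathrm{L}$). Let $k\ge 1$ and let $F$ be a $k$-chaos eigenfunction with eigenvalue $\lambda_k$, that is, $-\mathrm{L}F=\lambda_kF$ and $Q_{k+1}(\Gamma)(F)=0$ $\mu$-almost everywhere. Write $\Gamma(F)=\Gamma(F,F)$. Then $$\pi_{k-1}\int_E \Gamma(F)^2\,d\mu=\pi_k\int_E F^2\,\Gamma(F)\,d\mu+(-1)^k\int_E \Gamma(F)\; T_{k+1}\!\left(\frac{\mathrm{L}}{2}\right)\Gamma(F)\,d\mu .$$
   Context: Setting. $(E,\mathcal F,\mu)$ is a probability space; $\mathrm{L}$ is a Markov operator (the generator of a symmetric Markov semigroup, not necessarily a diffusion) acting on a suitable algebra $\mathcal A$ of real functions on $E$, with $\mathrm{L}1=0$, and $\mu$ is invariant and reversible: $\int_E f\,\mathrm{L}g\,d\mu=\int_E g\,\mathrm{L}f\,d\mu$. The carré du champ is $\Gamma(f,g)=\frac12[\mathrm{L}(fg)-f\mathrm{L}g-g\mathrm{L}f]$, $\Gamma(f)=\Gamma(f,f)\ge 0$; thus $\int_E f(-\mathrm{L}g)\,d\mu=\int_E\Gamma(f,g)\,d\mu$. $\mathrm{L}$ has pure point spectrum: $-\mathrm{L}$ has a countable sequence of eigenvalues $S=\{0=\lambda_0<\lambda_1<\lambda_2<\cdots\}$ and $L^2(\mu)$ is the orthogonal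 direct sum of the corresponding eigenspaces; $\mathrm{L}$ is ergodic ($\Gamma(f)=0$ implies $f$ constant $\mu$-a.e.). Standing assumption: eigenfunctions are assumed to satisfy all domain and integrability conditions needed for the quantities and identities involved (integration by parts/symmetry of $\mathrm{L}$, and the iterated gradients) to make sense and be valid. Iterated gradients: $\Gamma_0(f,g)=fg$, $\Gamma_1=\Gamma$, and for $m\ge2$, $\Gamma_m(f,g)=\frac12[\mathrm{L}\Gamma_{m-1}(f,g)-\Gamma_{m-1}(f,\mathrm{L}g)-\Gamma_{m-1}(g,\mathrm{L}f)]$; $\Gamma_m(f)=\Gamma_m(f,f)$. Polynomials: for $k\ge1$, $Q_k(X)=\prod_{i=0}^{k-1}(X-\lambda_i)=\sum_{i=1}^k\frac1{i!}Q_k^{(i)}(0)X^i$, and $Q_k(\Gamma)=\sum_{i=1}^k\frac1{i!}Q_k^{(i)}(0)\,\Gamma_i$ (bilinear form), with $Q_k(\Gamma)(F)$ meaning $Q_k(\Gamma)(F,F)$. For $k\ge1$, $$R_{k+1}(X)=\frac1{X^2}\big[Q_{k+1}(X)-Q_{k+1}^{(1)}(0)X\big]=\sum_{i=2}^{k+1}\frac1{i!}Q_{k+1}^{(i)}(0)X^{i-2},\qquad T_{k+1}(X)=R_{k+1}(X+\lambda_k)-R_{k+1}(\lambda_k).$$ $\pi_k=\lambda_1\cdots\lambda_k$ for $k\ge1$, $\pi_0=1$. *)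

(* Defs.v *)
From mathcomp Require Export all_boot all_order all_algebra.
From mathcomp Require Export all_classical all_reals all_analysis.
Set Implicit Arguments.
Unset Strict Implicit.
Unset Printing Implicit Defensive.
Import Order.TTheory GRing.Theory Num.Theory.
Import numFieldNormedType.Exports.
Local Open Scope classical_set_scope.
Local Open Scope ring_scope.

Section markov_operator.
Context (d : measure_display) (T : measurableType d) (R : realType).
Context (mu : probability T R).

(* Elements of L^2(mu) are represented by functions; identities between them
   hold up to mu-null sets. Operators are total Rocq functions of which only the
   restriction to t >= 0 and f in L^2(mu) (resp. to the algebra A) matters. *)

Record markov_semigroup (P : R -> (T -> R) -> (T -> R)) : Prop := {
  semigroup_L2 : forall (t : R) f, 0 <= t ->
    f \in Lfun mu 2%:E -> P t f \in Lfun mu 2%:E ;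
  semigroup_lin : forall (t a : R) f g, 0 <= t ->
    f \in Lfun mu 2%:E -> g \in Lfun mu 2%:E ->
    P t (a *: f + g) = a *: P t f + P t g %[ae mu] ;
  semigroup_ge0 : forall (t : R) f, 0 <= t -> f \in Lfun mu 2%:E ->
    (\forall x \ae mu, 0 <= f x) -> \forall x \ae mu, 0 <= P t f x ;
  semigroup_1 : forall t : R, 0 <= t -> P t (cst 1) = cst 1 %[ae mu] ;
  semigroup_0 : forall f, f \in Lfun mu 2%:E -> P 0 f = f %[ae mu] ;
  semigroup_D : forall (s t : R) f, 0 <= s -> 0 <= t -> f \in Lfun mu 2%:E ->
    P (s + t) f = P s (P t f) %[ae mu] ;
  semigroup_cont : forall f, f \in Lfun mu 2%:E ->
    'N[mu]_2%:E[EFin \o (P t f - f)%R]%E @[t --> 0^'+] --> 0%E ;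
  semigroup_sym : forall (t : R) f g, 0 <= t ->
    f \in Lfun mu 2%:E -> g \in Lfun mu 2%:E ->
    \int[mu]_x (f x * P t g x) = \int[mu]_x (g x * P t f x) }.

(* f is in the L^2(mu)-domain of the generator of P, with value g *)
Definition generator (P : R -> (T -> R) -> (T -> R)) (f g : T -> R) : Prop :=
  [/\ f \in Lfun mu 2%:E, g \in Lfun mu 2%:E &
    'N[mu]_2%:E[EFin \o (t^-1 *: (P t f - f) - g)%R]%E @[t --> 0^'+] --> 0%E].

Definition carre_du_champ (L : (T -> R) -> (T -> R)) (f g : T -> R) : T -> R :=
  2^-1 *: (L (f * g) - f * L g - g * L f).

(* The recursion is started at Gamma_0; its first step, m = 1, yields the
   carre du champ. *)
Fixpoint iterated_gradient (L : (T -> R) -> (T -> R)) (m : nat)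
    (f g : T -> R) : T -> R :=
  if m is m'.+1 then
    2^-1 *: (L (iterated_gradient L m' f g)
             - iterated_gradient L m' f (L g)
             - iterated_gradient L m' g (L f))
  else f * g.

(* A is an L-stable algebra of integrable functions; being closed under
   products, it lies in every L^p(mu) with p finite, so that the integrals and
   iterated gradients built from elements of A all make sense. *)
Record markov_operator (P : R -> (T -> R) -> (T -> R)) (A : set (T -> R))
    (L : (T -> R) -> (T -> R)) : Prop := {
  algebra_1 : A (cst 1) ;
  algebra_lin : forall (a : R) f g, A f -> A g -> A (a *: f + g) ;
  algebra_mul : forall f g, A f -> A g -> A (f * g) ;
  algebra_integrable : forall f, A f -> mu.-integrable setT (EFin \o f) ;
  operator_stable : forall f, A f -> A (L f) ;
  operator_lin : forall (a : R) f g, A f -> A g ->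
    L (a *: f + g) = a *: L f + L g ;
  operator_1 : L (cst 1) = cst 0 ;
  operator_semigroup : markov_semigroup P ;
  operator_generator : forall f, A f -> generator P f (L f) ;
  operator_reversible : forall f g, A f -> A g ->
    \int[mu]_x (f x * L g x) = \int[mu]_x (g x * L f x) ;
  carre_du_champ_ge0 : forall f, A f ->
    \forall x \ae mu, 0 <= carre_du_champ L f f x }.

Definition ergodic (A : set (T -> R)) (L : (T -> R) -> (T -> R)) : Prop :=
  forall f, A f -> carre_du_champ L f f = cst 0 %[ae mu] ->
    exists c : R, f = cst c %[ae mu].

(* Eigenspace, in L^2(mu), of minus the generator. *)
Definition eigenspace (P : R -> (T -> R) -> (T -> R)) (a : R) : set (T -> R) :=
  [set f | generator P f ((- a) *: f)].

(* By symmetry of P, spectrum_total leaves no eigenvalue besides the lam n. *)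
Record pure_point_spectrum (P : R -> (T -> R) -> (T -> R)) (lam : nat -> R) :
    Prop := {
  spectrum_0 : lam 0%N = 0 ;
  spectrum_lt : forall m n, (m < n)%N -> lam m < lam n ;
  spectrum_eigenvalue : forall n, exists2 f, eigenspace P (lam n) f &
    ~ (f = cst 0 %[ae mu]) ;
  spectrum_orthogonal : forall m n f g, m != n ->
    eigenspace P (lam m) f -> eigenspace P (lam n) g ->
    \int[mu]_x (f x * g x) = 0 ;
  spectrum_total : forall f, f \in Lfun mu 2%:E ->
    exists2 g : nat -> T -> R, forall n, eigenspace P (lam n) (g n) &
      'N[mu]_2%:E[EFin \o (f - \sum_(i < n) g i)%R]%E @[n --> \oo] --> 0%E }.

Definition Qpoly (lam : nat -> R) (k : nat) : {poly R} :=
  \prod_(i < k) ('X - (lam i)%:P).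

Definition Qgradient (L : (T -> R) -> (T -> R)) (lam : nat -> R) (k : nat)
    (f g : T -> R) : T -> R :=
  \sum_(1 <= i < k.+1)
    ((i`!%:R)^-1 * (Qpoly lam k)^`(i).[0]) *: iterated_gradient L i f g.

Definition chaos_eigenfunction (A : set (T -> R)) (L : (T -> R) -> (T -> R))
    (lam : nat -> R) (k : nat) (F : T -> R) : Prop :=
  [/\ A F, - L F = lam k *: F %[ae mu] &
      Qgradient L lam k.+1 F F = cst 0 %[ae mu]].

Definition Rpoly (lam : nat -> R) (k : nat) : {poly R} :=
  \sum_(2 <= i < k.+1)
    ((i`!%:R)^-1 * (Qpoly lam k)^`(i).[0]) *: 'X^(i - 2).

(* The shift is by lam (k - 1): T_(k+1) is centred at lam k. *)
Definition Tpoly (lam : nat -> R) (k : nat) : {poly R} :=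
  Rpoly lam k \Po ('X + (lam k.-1)%:P) - ((Rpoly lam k).[lam k.-1])%:P.

Definition poly_operator (p : {poly R}) (U : (T -> R) -> (T -> R))
    (f : T -> R) : T -> R :=
  \sum_(i < size p) p`_i *: iter i U f.

Definition eigenvalue_prod (lam : nat -> R) (k : nat) : R :=
  \prod_(1 <= i < k.+1) lam i.

End markov_operator.

(* Main.v *)
Require Import Defs.
From mathcomp Require Import measurable_realfun ring.
Import Order.TTheory GRing.Theory Num.Theory.
Import numFieldNormedType.Exports.
Local Open Scope classical_set_scope.
Local Open Scope ring_scope.

Set Implicit Arguments.
Unset Strict Implicit.

(** The identity is operator calculus with a single operator.  Put
    V = L/2 + lambda_k.  Since - L F = lambda_k F, every occurrence of L F in
    the recursion for the iterated gradients can be replaced by a multiple of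
    F, and the recursion collapses to Gamma_m(F) = V^m (F^2)
    ([iterated_gradient_eigen]); in particular Gamma(F) = V (F^2).  Hence
    Q_(k+1)(Gamma)(F) is Q_(k+1)(V)(F^2) ([Qgradient_eigen]).

    As Q_(k+1)(0) = 0, one has Q_(k+1) = (R_(k+1) X + q) X with
    q = Q_(k+1)'(0) = (-1)^k pi_k ([Qpoly_Rpoly], [Qpoly_coef1]), so the chaos
    hypothesis reads V (R_(k+1)(V) Gamma(F)) = - q Gamma(F).  Because V is
    symmetric for mu,
      int Gamma(F) R_(k+1)(V) Gamma(F) = int V(F^2) R_(k+1)(V) Gamma(F)
        = int F^2 V(R_(k+1)(V) Gamma(F)) = - q int F^2 Gamma(F).
    By its definition T_(k+1)(L/2) = R_(k+1)(V) - R_(k+1)(lambda_k), and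
    evaluating the factorization of Q_(k+1) at its root lambda_k, which is
    nonzero, gives R_(k+1)(lambda_k) = - (-1)^k pi_(k-1)
    ([Rpoly_horner]).  Substituting these values yields the theorem.

    The hypotheses on F hold only almost everywhere, so L has to respect
    almost-everywhere equality on A; this follows from reversibility
    ([operator_ae]). *)

(** * Polynomials of an operator *)

Section polynomial_calculus.
Context (R : realType) (d : measure_display) (X : measurableType d).
Implicit Types (p q : {poly R}) (f g : X -> R) (U : (X -> R) -> (X -> R)).

Lemma poly_operator_widen n p U f : (size p <= n)%N ->
  poly_operator p U f = \sum_(i < n) p`_i *: iter i U f.
Proof.
move=> pn; rewrite /poly_operator (big_ord_widen n (fun i => p`_i *: iter i U f) pn).
rewrite [RHS](bigID (fun i : 'I_n => (i < size p)%N)) /= [X in _ = _ + X]big1 ?addr0//.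
by move=> i; rewrite -leqNgt => /(nth_default 0) ->; rewrite scale0r.
Qed.

Lemma poly_operator_linear a p q U f :
  poly_operator (a *: p + q) U f = a *: poly_operator p U f + poly_operator q U f.
Proof.
pose n := maxn (size p) (size q).
have pn : (size p <= n)%N := leq_maxl _ _.
have qn : (size q <= n)%N := leq_maxr _ _.
have apqn : (size (a *: p + q)%R <= n)%N.
  by rewrite (leq_trans (size_polyD _ _))// geq_max qn andbT
    (leq_trans (size_scale_leq _ _)).
rewrite !(@poly_operator_widen n)// scaler_sumr -big_split/=.
by apply: eq_bigr => i _; rewrite coefD coefZ scalerDl scalerA.
Qed.

Lemma poly_operator0 U f : poly_operator 0 U f = 0.
Proof. by rewrite /poly_operator size_poly0 big_ord0. Qed.

Lemma poly_operatorMXaddC p a U f :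
  poly_operator (p * 'X + a%:P) U f = poly_operator p U (U f) + a *: f.
Proof.
rewrite (@poly_operator_widen (size p).+1); last by rewrite size_MXaddC; case: ifP.
rewrite big_ord_recl/= coefD coefMX coefC/= add0r addrC; congr (_ + _).
apply: eq_bigr => i _; rewrite coefD coefMX coefC/= addr0.
by rewrite -iterSr.
Qed.

Lemma poly_operatorDC p c U f :
  poly_operator (p + c%:P) U f = poly_operator p U f + c *: f.
Proof.
rewrite -[c%:P]add0r -[X in _ + (X + _)](mul0r 'X) -[p in LHS]scale1r.
by rewrite poly_operator_linear poly_operatorMXaddC poly_operator0 add0r scale1r.
Qed.

(** The operators at hand are total functions about which nothing is known
    outside the algebra A, hence linearity relative to a subset. *)
Definition linear_on (A : set (X -> R)) U :=
  (forall f, A f -> A (U f)) /\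
  (forall a f g, A f -> A g -> U (a *: f + g) = a *: U f + U g).

Context (A : set (X -> R)).
Hypothesis A0 : A 0.
Hypothesis AP : forall a f g, A f -> A g -> A (a *: f + g).

Lemma linear_on_poly_operator p U : linear_on A U -> linear_on A (poly_operator p U).
Proof.
move=> [AU UP]; elim/poly_ind: p => [|p c [IHA IHP]].
  split=> [f _|a f g _ _]; rewrite !poly_operator0//.
  by rewrite scaler0 addr0.
split=> [f Af|a f g Af Ag]; rewrite !poly_operatorMXaddC.
  by rewrite addrC; apply: AP => //; apply: IHA; apply: AU.
rewrite UP// IHP; [|exact: AU..].
by rewrite !scalerDr !scalerA (mulrC c) addrACA.
Qed.

Lemma poly_operator_comm p U f : linear_on A U -> A f ->
  U (poly_operator p U f) = poly_operator p U (U f).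
Proof.
move=> lU Af; have [AU UP] := lU; elim/poly_ind: p f Af => [|p c IH] f Af.
  by rewrite !poly_operator0 -{1}[0](scaler0 _ (-1)) -[X in U X]addr0 UP// scaleN1r addNr.
rewrite !poly_operatorMXaddC addrC UP// ?IH//; first by rewrite addrC.
  exact: AU.
by apply (linear_on_poly_operator p lU).1; exact: AU.
Qed.

(** Substituting X + c in the polynomial amounts to adding c to the operator;
    linearity is what allows the product in p(X + c) (X + c) to be read as a
    composition. *)
Lemma poly_operator_shift p c U f : linear_on A U -> A f ->
  poly_operator (p \Po ('X + c%:P)) U f =
  poly_operator p (fun g => U g + c *: g) f.
Proof.
move=> lU Af; elim/poly_ind: p f Af => [|p a IH] f Af.
  by rewrite comp_poly0 !poly_operator0.
have Uf : A (U f) by exact: lU.1.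
have Vf : A (U f + c *: f) by rewrite addrC; exact: AP.
rewrite comp_poly_MXaddC poly_operatorMXaddC -IH// mulrDr addrAC addrC mulrC mul_polyC.
rewrite poly_operator_linear poly_operatorMXaddC.
by rewrite [U f + _]addrC (linear_on_poly_operator _ lU).2// addrA.
Qed.
End polynomial_calculus.

(** * The polynomials Q and R *)

Section polynomials.
Context (R : realType) (lam : nat -> R).

Lemma Qpoly_taylor_coef k i :
  (i`!%:R)^-1 * (Qpoly lam k)^`(i).[0] = (Qpoly lam k)`_i.
Proof.
rewrite horner_coef0 coef_derivn addn0 ffactnn -[X in _ * X]mulr_natl.
by rewrite mulKf// pnatr_eq0 -lt0n fact_gt0.
Qed.

Lemma size_Qpoly k : size (Qpoly lam k) = k.+1.
Proof. by rewrite /Qpoly size_prod_XsubC /index_enum -enumT size_enum_ord. Qed.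

Hypothesis lam0 : lam 0%N = 0.

Lemma Qpoly_coef0 k : (Qpoly lam k.+1)`_0 = 0.
Proof. by rewrite /Qpoly big_ord_recl /= lam0 subr0 mulrC coefMX. Qed.

(** The factor X coming from lambda_0 = 0 turns this coefficient into the value
    at 0 of the product of the other factors. *)
Lemma Qpoly_coef1 k : (Qpoly lam k.+1)`_1 = (-1) ^+ k * eigenvalue_prod lam k.
Proof.
rewrite /Qpoly big_ord_recl /= lam0 subr0 mulrC coefMX/= -horner_coef0 horner_prod.
under eq_bigr do rewrite hornerXsubC sub0r.
by rewrite prodrN card_ord /eigenvalue_prod big_add1 big_mkord.
Qed.

Lemma Qpoly_Rpoly k :
  Qpoly lam k.+1 = (Rpoly lam k.+1 * 'X + ((Qpoly lam k.+1)`_1)%:P) * 'X.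
Proof.
apply/polyP => -[|[|i]]; rewrite coefMX/= ?Qpoly_coef0//.
  by rewrite coefD coefMX coefC/= add0r.
rewrite coefD coefMX coefC/= addr0 /Rpoly.
under eq_bigr do rewrite Qpoly_taylor_coef.
rewrite big_add1 big_add1/= big_mkord.
under eq_bigr do rewrite subn2/=.
rewrite coef_sumMXn.
have [ik|ki] := ltnP i k.
  by rewrite (big_pred1 (Ordinal ik)).
rewrite big_pred0; last by move=> j; apply/eqP => ji; move: ki; rewrite -ji leqNgt ltn_ord.
by rewrite nth_default// size_Qpoly.
Qed.

(** The factorization [Qpoly_Rpoly] vanishes at the root lambda_(k+1) of
    Q_(k+2); the outer X cancels, and then the inner one cancels against the
    last factor lambda_(k+1) of pi_(k+1). *)
Lemma Rpoly_horner k : lam k.+1 != 0 ->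
  (Rpoly lam k.+2).[lam k.+1] = - ((-1) ^+ k.+1 * eigenvalue_prod lam k).
Proof.
move=> lk0.
have /eqP : (Qpoly lam k.+2).[lam k.+1] = 0.
  by rewrite /Qpoly big_ord_recr /= hornerM hornerXsubC subrr mulr0.
rewrite Qpoly_Rpoly Qpoly_coef1 hornerMX hornerMXaddC mulf_eq0 (negbTE lk0) orbF.
rewrite /eigenvalue_prod big_nat_recr//= mulrA -mulrDl mulf_eq0 (negbTE lk0) orbF.
by rewrite addr_eq0 => /eqP.
Qed.
End polynomials.

(** * The algebra of functions and almost-everywhere equality *)

Section markov.
Context (d : measure_display) (T : measurableType d) (R : realType).
Context (mu : probability T R) (P : R -> (T -> R) -> (T -> R)).
Context (A : set (T -> R)) (L : (T -> R) -> (T -> R)).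
Hypothesis hL : markov_operator mu P A L.
Implicit Types f g h : T -> R.
Let AP := algebra_lin hL.
Let AM := algebra_mul hL.

Lemma algebra_0 : A 0.
Proof. by rewrite -[0](addNr (cst 1)) -scaleN1r; apply: AP; exact: algebra_1 hL. Qed.

Lemma algebra_D f g : A f -> A g -> A (f + g).
Proof. by move=> Af Ag; rewrite -[f]scale1r; exact: AP. Qed.

Lemma algebra_Z a f : A f -> A (a *: f).
Proof. by move=> Af; rewrite -[_ *: _]addr0; apply: AP => //; exact: algebra_0. Qed.

Lemma algebra_B f g : A f -> A g -> A (f - g).
Proof. by move=> Af Ag; rewrite addrC -scaleN1r; exact: AP. Qed.

Lemma operator_0 : L 0 = 0.
Proof.
have A0 := algebra_0.
by rewrite -[X in L X](addNr 0) -scaleN1r (operator_lin hL)// scaleN1r addNr.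
Qed.

Lemma operator_Z a f : A f -> L (a *: f) = a *: L f.
Proof.
move=> Af; rewrite -[X in L X]addr0 (operator_lin hL)//; last exact: algebra_0.
by rewrite operator_0 addr0.
Qed.

Lemma algebra_measurable f : A f -> measurable_fun setT (EFin \o f).
Proof. by move/(algebra_integrable hL)/measurable_int. Qed.

Lemma ae_eq_Rintegral f g : A f -> A g -> f = g %[ae mu] ->
  \int[mu]_x f x = \int[mu]_x g x.
Proof.
move=> Af Ag fg; congr fine; apply: ae_eq_integral => //.
- exact: algebra_measurable.
- exact: algebra_measurable.
- exact: ae_eq_comp fg.
Qed.

Lemma Rintegral_linear a f g : A f -> A g ->
  \int[mu]_x (a * f x + g x) = a * \int[mu]_x f x + \int[mu]_x g x.
Proof.
move=> Af Ag; rewrite RintegralD ?RintegralZl//;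
  apply: (algebra_integrable hL) => //.
exact: (@algebra_Z a f).
Qed.

Lemma Rintegral_sqr_eq0 h : A h -> \int[mu]_x (h x * h x) = 0 -> h = 0 %[ae mu].
Proof.
move=> Ah h0; have Ahh : A (h * h) by exact: AM.
have I0 : (\int[mu]_x (h x * h x)%:E = 0)%E.
  have fin := integrable_fin_num measurableT (algebra_integrable hL Ahh).
  by have := fineK fin; rewrite -[X in _ = X -> _]/(\int[mu]_x (h x * h x)%:E)%E
    => <-; rewrite -[fine _]/(\int[mu]_x (h x * h x)) h0.
have : (\int[mu]_x `|(h x * h x)%:E| = 0)%E.
  by rewrite -I0; apply: eq_integral => x _; rewrite gee0_abs// lee_fin -expr2 sqr_ge0.
move/(ae_eq_integral_abs mu measurableT (algebra_measurable Ahh)).1.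
apply: filterS => x /[apply] /= -[] /eqP.
by rewrite mulf_eq0 orbb => /eqP.
Qed.

(** For h in A that vanishes almost everywhere, reversibility gives
    int (L h)^2 = int h L (L h) = 0, so L h vanishes almost everywhere too. *)
Lemma operator_ae f g : A f -> A g -> f = g %[ae mu] -> L f = L g %[ae mu].
Proof.
move=> Af Ag fg; pose h := f - g.
have Ah : A h by exact: algebra_B.
have AL := operator_stable hL.
have h0 : h = 0 %[ae mu].
  by apply: filterS fg => x /[apply] fg; rewrite /h !fctE fg subrr.
have Lh0 : L h = 0 %[ae mu].
  apply: Rintegral_sqr_eq0; first exact: AL.
  rewrite (operator_reversible hL) => //; last exact: AL.
  rewrite (@ae_eq_Rintegral (h * L (L h)) 0) //; first by rewrite Rintegral_cst// mul0r.
  - by apply: AM => //; exact/AL/AL.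
  - exact: algebra_0.
  - by apply: filterS h0 => x /[apply] h0; rewrite !fctE h0 mul0r.
apply: filterS Lh0 => x /[apply].
rewrite /h addrC -scaleN1r (operator_lin hL)// scaleN1r !fctE addrC => /eqP.
by rewrite subr_eq0 => /eqP.
Qed.

(** * Iterated gradients of an eigenfunction *)

Lemma iterated_gradient_stable m f g : A f -> A g -> A (iterated_gradient L m f g).
Proof.
have AL := operator_stable hL.
elim: m f g => [|m IH] f g Af Ag /=; first exact: AM.
by apply: algebra_Z; apply: algebra_B; [apply: algebra_B|]; [apply: AL|..];
  apply: IH => //; apply: AL.
Qed.

(** The recursion exchanges its two arguments, so the two homogeneity
    statements have to be proved together. *)
Lemma iterated_gradientZ m a f g : A f -> A g ->
  iterated_gradient L m f (a *: g) = a *: iterated_gradient L m f g /\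
  iterated_gradient L m (a *: g) f = a *: iterated_gradient L m g f.
Proof.
have AL := operator_stable hL.
elim: m f g => [|m IH] f g Af Ag /=; first by split; apply/funext => x; rewrite !fctE /GRing.scale/=; ring.
have AG := @iterated_gradient_stable m.
have [fg gf] := IH _ _ Af Ag.
have [fLg _] := IH _ _ Af (AL _ Ag).
have [_ gLf] := IH _ _ (AL _ Af) Ag.
have ALZ := operator_Z a.
rewrite !(ALZ g)// fg gf fLg gLf !ALZ; [|exact: iterated_gradient_stable..].
by rewrite !(scalerA, scalerBr) !(mulrC a).
Qed.

Lemma iterated_gradient_ae m f f' g g' : A f -> A f' -> A g -> A g' ->
  f = f' %[ae mu] -> g = g' %[ae mu] ->
  iterated_gradient L m f g = iterated_gradient L m f' g' %[ae mu].
Proof.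
have AL := operator_stable hL.
have AG := iterated_gradient_stable.
elim: m f f' g g' => [|m IH] f f' g g' Af Af' Ag Ag' ff' gg' /=.
  by apply: filterS2 ff' gg' => x fx gx Dx; rewrite !fctE fx// gx.
have Lff' := operator_ae Af Af' ff'.
have Lgg' := operator_ae Ag Ag' gg'.
have e1 := operator_ae (AG m _ _ Af Ag) (AG m _ _ Af' Ag') (IH _ _ _ _ Af Af' Ag Ag' ff' gg').
have e2 := IH _ _ _ _ Af Af' (AL _ Ag) (AL _ Ag') ff' Lgg'.
have e3 := IH _ _ _ _ Ag Ag' (AL _ Af) (AL _ Af') gg' Lff'.
by apply: filterS3 e1 e2 e3 => x e1 e2 e3 Dx; rewrite !fctE e1// e2// e3.
Qed.

Definition shifted_operator (c : R) (f : T -> R) : T -> R := 2^-1 *: L f + c *: f.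

Lemma half_operator_linear_on : linear_on A (fun f => 2^-1 *: L f).
Proof.
split=> [f Af|a f g Af Ag]; first by apply/algebra_Z/(operator_stable hL).
by rewrite (operator_lin hL)// scalerDr !scalerA mulrC.
Qed.

Lemma shifted_operator_linear_on c : linear_on A (shifted_operator c).
Proof.
have [AU UP] := half_operator_linear_on.
split=> [f Af|a f g Af Ag]; rewrite /shifted_operator.
  by apply: algebra_D; [exact: AU|exact: algebra_Z].
by rewrite UP// !scalerDr !scalerA (mulrC c) addrACA.
Qed.

Lemma shifted_operator_ae c f g : A f -> A g -> f = g %[ae mu] ->
  shifted_operator c f = shifted_operator c g %[ae mu].
Proof.
move=> Af Ag fg; apply: filterS2 fg (operator_ae Af Ag fg) => x fg Lfg Dx.
by rewrite /shifted_operator !fctE fg// Lfg.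
Qed.

Lemma poly_operator_ae p U f g : linear_on A U ->
  (forall f g, A f -> A g -> f = g %[ae mu] -> U f = U g %[ae mu]) ->
  A f -> A g -> f = g %[ae mu] ->
  poly_operator p U f = poly_operator p U g %[ae mu].
Proof.
move=> [AU _] Uae; elim/poly_ind: p f g => [|p c IH] f g Af Ag fg.
  by rewrite !poly_operator0; exact: aeW.
rewrite !poly_operatorMXaddC.
apply: filterS2 fg (IH _ _ (AU _ Af) (AU _ Ag) (Uae _ _ Af Ag fg)) => x fg e Dx.
by rewrite !fctE fg// e.
Qed.

Lemma shifted_operator_sym c f g : A f -> A g ->
  \int[mu]_x (f x * shifted_operator c g x) = \int[mu]_x (g x * shifted_operator c f x).
Proof.
have AL := operator_stable hL.
have expand u v : A u -> A v -> \int[mu]_x (u x * shifted_operator c v x) =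
    2^-1 * \int[mu]_x (u x * L v x) + c * \int[mu]_x (u x * v x).
  move=> Au Av; have AuLv : A (u * L v) by apply: AM => //; exact: AL.
  have Auv : A (u * v) by exact: AM.
  transitivity (\int[mu]_x (2^-1 * (u * L v) x + (c *: (u * v)) x)).
    by apply: eq_Rintegral => x _; rewrite /shifted_operator !fctE /GRing.scale/=; ring.
  rewrite (Rintegral_linear _ AuLv (algebra_Z c Auv)); congr (_ + _).
  by rewrite RintegralZl//; exact: (algebra_integrable hL).
move=> Af Ag; rewrite !expand// (operator_reversible hL)//; congr (_ + _ * _).
by apply: eq_Rintegral => x _; rewrite mulrC.
Qed.

(** Replacing L f by - lambda f in the recursion gives
    Gamma_(m+1)(f) = (L Gamma_m(f) + 2 lambda Gamma_m(f)) / 2, which is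
    L/2 + lambda applied to Gamma_m(f). *)
Lemma iterated_gradient_eigen m lambda f : A f -> - L f = lambda *: f %[ae mu] ->
  iterated_gradient L m f f = iter m (shifted_operator lambda) (f * f) %[ae mu].
Proof.
move=> Af Lf; elim: m => [|m IH]; first exact: aeW.
have AL := operator_stable hL.
have AG := @iterated_gradient_stable m f f Af Af.
have Lf' : L f = (- lambda) *: f %[ae mu].
  by apply: filterS Lf => x /[apply]; rewrite !fctE scaleNr => <-; rewrite opprK.
have AI : A (iter m (shifted_operator lambda) (f * f)).
  elim: (m) => [|n]; first exact: AM.
  exact: (shifted_operator_linear_on lambda).1.
have e1 := shifted_operator_ae lambda AG AI IH.
have e2 := iterated_gradient_ae m Af Af (AL _ Af) (algebra_Z _ Af) (aeW _ (fun=> fun=> erefl)) Lf'.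
apply: filterS2 e1 e2 => x e1 e2 Dx /=.
rewrite -e1// /shifted_operator !fctE e2// (iterated_gradientZ _ _ _ _).1//.
by rewrite fctE /GRing.scale/= mulNr opprK; field.
Qed.

Lemma Qgradient_eigen (lam : nat -> R) n lambda f :
  lam 0%N = 0 -> A f -> - L f = lambda *: f %[ae mu] ->
  Qgradient L lam n.+1 f f =
    poly_operator (Qpoly lam n.+1) (shifted_operator lambda) (f * f) %[ae mu].
Proof.
move=> lam0 Af Lf.
have := ae_foralln (fun m => iterated_gradient_eigen m Af Lf).
apply: filterS => x e Dx.
rewrite /poly_operator size_Qpoly big_ord_recl Qpoly_coef0// scale0r add0r.
rewrite /Qgradient big_add1 succnK big_mkord !fct_sumE.
by apply: eq_bigr => i _; rewrite Qpoly_taylor_coef lift0 !fctE e.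
Qed.

End markov.

(** * The chaos identity *)

Theorem theorem6 (d : measure_display) (T : measurableType d) (R : realType)
    (mu : probability T R)
    (P : R -> (T -> R) -> (T -> R))
    (A : set (T -> R)) (L : (T -> R) -> (T -> R))
    (lam : nat -> R) (k : nat) (F : T -> R)
    (hL : markov_operator mu P A L)
    (herg : ergodic mu A L)
    (hspec : pure_point_spectrum mu P lam)
    (hk : (1 <= k)%N)
    (hF : chaos_eigenfunction mu A L lam k F) :
  let GF := carre_du_champ L F F in
  eigenvalue_prod lam k.-1 * \int[mu]_x (GF x ^+ 2)
  = eigenvalue_prod lam k * \int[mu]_x (F x ^+ 2 * GF x)
    + (-1) ^+ k * \int[mu]_x
        (GF x * poly_operator (Tpoly lam k.+1) (fun f => 2^-1 *: L f) GF x).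
Proof.
move=> GF; have [AF LF QF] := hF.
have lam0 := spectrum_0 hspec.
case: k hk LF QF {hF} => // k _ LF QF.
have lk0 : lam k.+1 != 0.
  by rewrite gt_eqF// -lam0; exact: spectrum_lt hspec _ _ _.
have AM := algebra_mul hL.
have A0 := algebra_0 hL.
have AP := algebra_lin hL.
set U := fun f : T -> R => 2^-1 *: L f.
pose V := shifted_operator L (lam k.+1).
have lU : linear_on A U := half_operator_linear_on hL.
have lV : linear_on A V := shifted_operator_linear_on hL (lam k.+1).
have AG : A GF := iterated_gradient_stable hL 1 AF AF.
have AFF : A (F * F) by exact: AM.
have AV : A (V (F * F)) by exact: lV.1.
have GV : GF = V (F * F) %[ae mu] := iterated_gradient_eigen hL 1 AF LF.
pose S := poly_operator (Rpoly lam k.+2) V GF.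
have AS : A S by exact: (linear_on_poly_operator A0 AP _ lV).1.
(* The chaos hypothesis, through the factorization Q = (R X + q) X. *)
have VS : V S = - (Qpoly lam k.+2)`_1 *: GF %[ae mu].
  have Vae := shifted_operator_ae hL (lam k.+1).
  have Q0 := Qgradient_eigen hL k.+1 lam0 AF LF.
  (* The trailing + 0 gives Q the Horner shape p * 'X + c%:P. *)
  rewrite Qpoly_Rpoly// -[X in poly_operator X]addr0 !poly_operatorMXaddC scale0r addr0
    -/V -(poly_operator_comm A0 AP) // in Q0.
  set S' := poly_operator _ V (V (F * F)) in Q0.
  have AS' : A S'.
    exact: (linear_on_poly_operator A0 AP _ lV).1.
  have VSae := Vae _ _ AS AS' (poly_operator_ae _ lV Vae AG AV GV).
  apply: filterS3 (filterI QF Q0) VSae GV => x [q0 q1] vs gv Dx.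
  have {q0 q1} : 0 = V S' x + (Qpoly lam k.+2)`_1 * V (F * F) x.
    by rewrite -[LHS](q0 Dx) (q1 Dx).
  rewrite -gv// -[V S' x](vs Dx) => /esym/eqP; rewrite addr_eq0 => /eqP VSx.
  by rewrite scaleNr; exact: VSx.
(* Gamma(F) = V (F^2), and V moves to the other factor by symmetry. *)
have E1 : \int[mu]_x (GF x * S x) =
   - (Qpoly lam k.+2)`_1 * \int[mu]_x (F x ^+ 2 * GF x).
  transitivity (\int[mu]_x (V (F * F) x * S x)).
    apply: (ae_eq_Rintegral hL (AM _ _ AG AS) (AM _ _ AV AS)).
    by apply: filterS GV => x gv Dx; rewrite !fctE gv.
  transitivity (\int[mu]_x ((F * F) x * V S x)).
    rewrite [RHS](shifted_operator_sym hL)//.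
    by apply: eq_Rintegral => x _; rewrite mulrC.
  have AFG : A (F * F * GF) by exact: AM.
  transitivity (\int[mu]_x (- (Qpoly lam k.+2)`_1 * (F * F * GF) x)).
    apply: (ae_eq_Rintegral hL (AM _ _ AFF (lV.1 _ AS)) (algebra_Z hL _ AFG)).
    by apply: filterS VS => x vs Dx; rewrite -[LHS]/(F x * F x * V S x) vs// !fctE /GRing.scale/=; ring.
  by rewrite RintegralZl//; exact: (algebra_integrable hL).
(* T is R recentred at the eigenvalue, and the shift turns L/2 into V. *)
have E2 : \int[mu]_x (GF x * poly_operator (Tpoly lam k.+2) U GF x) =
    - (Rpoly lam k.+2).[lam k.+1] * \int[mu]_x (GF x ^+ 2) + \int[mu]_x (GF x * S x).
  rewrite -(Rintegral_linear hL _ (AM _ _ AG AG) (AM _ _ AG AS)).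
  apply: eq_Rintegral => x _.
  rewrite /Tpoly -polyCN poly_operatorDC (poly_operator_shift A0 AP)//.
  by rewrite !fctE /GRing.scale/= /S /V /shifted_operator; ring.
rewrite E2 E1 Rpoly_horner// Qpoly_coef1//.
rewrite opprK mulrDr !mulrA mulrN !mulrA -!exprD addnn -signr_odd odd_double.
ring.
Qed.
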